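(* For every positive integer $l$, there exists a graph $G$ such that $def(G)>0$ and $W_{def}(G)-w_{def}(G)\geq l$.
   Context: All graphs are finite, undirected, without loops or multiple edges. A proper $t$-edge-coloring of $G$ is a map $\alpha:E(G)\to\{1,\ldots,t\}$ such that all $t$ colors are used and adjacent edges receive different colors. The spectrum $S(v,\alpha)$ of a vertex $v$ is the set of colors on edges incident to $v$. For a finite set $A$ of integers, $def(A)=\max A-\min A-|A|+1$ ($def(\emptyset)=0$). Define $def(v,\alpha)=def(S(v,\alpha))$, $def(G,\alpha)=\sum_{v\in V(G)}def(v,\alpha)$, and $def(G)=\min_\alpha def(G,\alpha)$ over all proper edge-colorings $\alpha$ of $G$. $w_{def}(G)$ and $W_{def}(G)$ are the smallest and largest $t$ such that $G$ has a proper $t$-edge-coloring $\alpha$ with $def(G,\alpha)=def(G)$. *)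

(* Defs.v *)
From mathcomp Require Import all_boot.

Set Implicit Arguments.
Unset Strict Implicit.
Unset Printing Implicit Defensive.

Record sgraph := SGraph {
  vertex :> finType;
  adj : rel vertex;
  adj_sym : symmetric adj;
  adj_irrefl : irreflexive adj }.

Section EdgeColoring.

Variable G : sgraph.

Definition edges : {set {set G}} :=
  [set [set p.1; p.2] | p : G * G & adj p.1 p.2].

Definition edge : finType := {e : {set G} | e \in edges}.

Definition adjacent_edges (e f : edge) : bool :=
  (e != f) && (val e :&: val f != set0).

(* ['I_t.+1] is {0, ..., t}; the first conjunct of [proper_coloring] rules the *)
(* value 0 out, so that the colors are 1, ..., t.                              *)
Definition coloring (t : nat) := {ffun edge -> 'I_t.+1}.

Definition proper_coloring (t : nat) (alpha : coloring t) : bool :=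
  [&& [forall e, 0 < alpha e],
      [forall c : 'I_t.+1, (0 < c) ==> [exists e, alpha e == c]]
    & [forall e, forall f, adjacent_edges e f ==> (alpha e != alpha f)]].

Definition spectrum (t : nat) (alpha : coloring t) (v : G) : {set 'I_t.+1} :=
  [set alpha e | e : edge & v \in val e].

End EdgeColoring.

Definition max_set (n : nat) (A : {set 'I_n}) : nat := \max_(i in A) i.

(* The default value [n] is larger than every element of [A]. *)
Definition min_set (n : nat) (A : {set 'I_n}) : nat :=
  \big[minn/n]_(i in A) i.

(* For nonempty [A] no subtraction is truncated, by [def_set_addn] below. *)
Definition def_set (n : nat) (A : {set 'I_n}) : nat :=
  if A == set0 then 0 else (max_set A - min_set A + 1) - #|A|.

Lemma min_set_le n (A : {set 'I_n}) i : i \in A -> min_set A <= i.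
Proof.
move=> iA; rewrite /min_set; have := mem_index_enum i.
elim: (index_enum _) => // j s IHs; rewrite inE big_cons.
case/predU1P=> [<-|/IHs le_i]; first by rewrite iA geq_minl.
by case: ifP => // _; rewrite geq_min le_i orbT.
Qed.

Lemma max_set_ge n (A : {set 'I_n}) i : i \in A -> i <= max_set A.
Proof. by move=> iA; rewrite /max_set (bigD1 i) //= leq_maxl. Qed.

Lemma min_set_in n (A : {set 'I_n}) : A != set0 ->
  exists2 i : 'I_n, i \in A & min_set A = i.
Proof.
case/set0Pn=> j jA.
case: (arg_minnP (fun i : 'I_n => i : nat) jA) => i iA imin.
exists i => //; apply/eqP; rewrite eqn_leq min_set_le //=.
rewrite /min_set; elim/big_ind: _ => [|a b ha hb|k kA].
- exact: ltnW.
- by rewrite leq_min ha.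
- exact: imin.
Qed.

Lemma max_set_in n (A : {set 'I_n}) : A != set0 ->
  exists2 i : 'I_n, i \in A & max_set A = i.
Proof.
case/set0Pn=> j jA; have A0 : 0 < #|A| by apply/card_gt0P; exists j.
by have [i iA mE] := eq_bigmax_cond (fun i : 'I_n => i : nat) A0; exists i.
Qed.

Lemma card_set_le n (A : {set 'I_n}) :
  A != set0 -> #|A| <= max_set A - min_set A + 1.
Proof.
move=> A0; rewrite addn1 -(size_iota (min_set A) (max_set A - min_set A).+1).
rewrite cardE -(size_map val); apply: uniq_leq_size.
  by rewrite (map_inj_uniq val_inj) enum_uniq.
move=> k /mapP[i]; rewrite mem_enum => iA ->; rewrite mem_iota /=.
have lo := min_set_le iA; have hi := max_set_ge iA.
by rewrite lo addnS ltnS subnKC // (leq_trans lo).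
Qed.

Lemma def_set_addn n (A : {set 'I_n}) : A != set0 ->
  def_set A + #|A| + min_set A = max_set A + 1.
Proof.
move=> A0; rewrite /def_set (negbTE A0) subnK ?card_set_le //.
have [i iA mE] := min_set_in A0.
by rewrite addnAC subnK // mE max_set_ge.
Qed.

Section Deficiency.

Variable G : sgraph.

Definition def_coloring (t : nat) (alpha : coloring G t) : nat :=
  \sum_(v : G) def_set (spectrum alpha v).

Definition has_def (t d : nat) : bool :=
  [exists alpha : coloring G t,
     proper_coloring alpha && (def_coloring alpha == d)].

Lemma has_defP t d :
  reflect (exists2 alpha : coloring G t,
             proper_coloring alpha & def_coloring alpha = d)
          (has_def t d).
Proof.
apply: (iffP existsP) => [[a /andP[pa /eqP da]]|[a pa da]]; exists a => //.
by rewrite pa da eqxx.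
Qed.

Lemma proper_coloring_le t (alpha : coloring G t) :
  proper_coloring alpha -> t <= #|edge G|.
Proof.
case/and3P=> _ /forallP surj _.
have -> : t = #|[set lift ord0 i | i : 'I_t]|.
  by rewrite card_imset ?card_ord //; exact: lift_inj.
have sub : [set lift ord0 i | i : 'I_t] \subset [set alpha e | e : edge G].
  apply/subsetP=> _ /imsetP[i _ ->].
  have /existsP[e /eqP <-] := implyP (surj (lift ord0 i)) isT.
  exact: imset_f.
by rewrite (leq_trans (subset_leq_card sub)) // leq_imset_card.
Qed.

Lemma has_def_le t d : has_def t d -> t <= #|edge G|.
Proof. by case/has_defP=> a /proper_coloring_le. Qed.

Lemma proper_coloring_exists :
  exists alpha : coloring G #|edge G|, proper_coloring alpha.
Proof.
exists [ffun e => lift ord0 (enum_rank e)]; apply/and3P; split.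
- by apply/forallP=> e; rewrite ffunE.
- apply/forallP=> c; apply/implyP=> c0; case: (unliftP ord0 c) => [i ci|ci].
    by apply/existsP; exists (enum_val i); rewrite ffunE enum_valK ci.
  by rewrite ci in c0.
- apply/forallP=> e; apply/forallP=> f; apply/implyP=> /andP[ef _].
  by rewrite !ffunE (inj_eq lift_inj) (inj_eq enum_rank_inj).
Qed.

(* The bound on [t] is harmless: all [t] colors are used, so [t] is at most *)
(* the number of edges; see [def_graph_le].                                 *)
Definition is_def (d : nat) : bool := [exists t : 'I_#|edge G|.+1, has_def t d].

Lemma is_def_ex : exists d, is_def d.
Proof.
have [a pa] := proper_coloring_exists; exists (def_coloring a).
by apply/existsP; exists ord_max; apply/has_defP; exists a.
Qed.

Definition def_graph : nat := ex_minn is_def_ex.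

Lemma def_graph_attained : exists t, has_def t def_graph.
Proof.
by rewrite /def_graph; case: ex_minnP => d /existsP[t ht] _; exists t.
Qed.

Lemma def_graph_le t (alpha : coloring G t) :
  proper_coloring alpha -> def_graph <= def_coloring alpha.
Proof.
move=> pa; rewrite /def_graph; case: ex_minnP => d _; apply.
have ht : t < #|edge G|.+1 by rewrite ltnS (proper_coloring_le pa).
by apply/existsP; exists (Ordinal ht); apply/has_defP; exists alpha.
Qed.

Definition w_def : nat := ex_minn def_graph_attained.

Definition W_def : nat :=
  ex_maxn def_graph_attained (fun t => @has_def_le t def_graph).

End Deficiency.

(* Main.v *)
(* Take a triangle together with l disjoint edges. The three colors of the    *)
(* triangle are distinct, so two of them differ by at least 2, and the vertex *)
(* where these meet has a positive deficiency. Coloring the triangle with 1,  *)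
(* 2, 3 gives total deficiency 1 whatever the colors of the disjoint edges;   *)
(* these can all be 1, or be 4, ..., l + 3.                                   *)
Require Import Defs.
From mathcomp Require Import all_boot.
From mathcomp Require Import zify.

Set Implicit Arguments.
Unset Strict Implicit.
Unset Printing Implicit Defensive.

(** The deficiency of a triangle with disjoint edges added is exactly 1. [triangle_def_gt0] bounds
    it below: if all three corners had deficiency 0, the three distinct colors of the triangle would
    be pairwise consecutive. [tm_has_def1] bounds it above and leaves the disjoint edges free, since
    their ends have singleton spectra. Hence both 3 and [l + 3] colors attain the minimum. *)

Lemma def_set2 n (i j : 'I_n) : def_set [set i; j] = ((i - j) + (j - i)).-1.
Proof.
have A0 : [set i; j] != set0 by apply/set0Pn; exists i; rewrite set21.
have := def_set_addn A0; rewrite cards2.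
have := min_set_le (set21 i j); have := min_set_le (set22 i j).
have := max_set_ge (set21 i j); have := max_set_ge (set22 i j).
have [x + ->] := min_set_in A0; have [y + ->] := max_set_in A0.
rewrite -[i == j]val_eqE !inE /=.
(* For [i = j] the truncated predecessor of 0 is the deficiency 0 of a singleton. *)
by move=> /orP[] /eqP-> /orP[] /eqP->; case: (ltngtP i j); lia.
Qed.

Section EdgeOf.

Variable G : sgraph.

Lemma mem_edges (x y : G) : adj x y -> [set x; y] \in edges G.
Proof. by move=> xy; apply/imsetP; exists (x, y); rewrite ?inE. Qed.

Definition edge_of (x y : G) (xy : adj x y) : edge G :=
  exist _ [set x; y] (mem_edges xy).

Lemma edge_ofP (e : edge G) (x : G) :
  x \in val e -> exists y, exists xy : adj x y, e = edge_of xy.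
Proof.
have /imsetP[[u v]] := valP e; rewrite inE /= => uv eE.
rewrite [val e]eE !inE => /orP[] /eqP xE; subst x.
  by exists v, uv; apply: val_inj.
have vu : adj v u by rewrite adj_sym.
by exists u, vu; apply: val_inj; rewrite /= eE setUC.
Qed.

Lemma edge_ofC (x y : G) (xy : adj x y) (yx : adj y x) :
  edge_of xy = edge_of yx.
Proof. by apply: val_inj; rewrite /= setUC. Qed.

Lemma proper_coloring_neq t (alpha : coloring G t) (x y z : G)
    (xy : adj x y) (xz : adj x z) :
  proper_coloring alpha -> y != z -> alpha (edge_of xy) != alpha (edge_of xz).
Proof.
move=> /and3P[_ _ /forallP/(_ (edge_of xy))/forallP/(_ (edge_of xz))].
move=> /implyP proper yz; apply/proper/andP; split; last first.
  by apply/set0Pn; exists x; rewrite !inE eqxx.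
rewrite -val_eqE /=; apply/eqP=> /setP/(_ y); rewrite !inE eqxx orbT.
case/esym/orP=> /eqP yE; last by rewrite yE eqxx in yz.
by have := adj_irrefl x; rewrite -{2}yE xy.
Qed.

(** The vertices [y] and [z] may coincide, so that vertices of degree 1 are covered too. *)
Lemma spectrum2 t (alpha : coloring G t) (x y z : G)
    (xy : adj x y) (xz : adj x z) :
  (forall w, adj x w -> w = y \/ w = z) ->
  spectrum alpha x = [set alpha (edge_of xy); alpha (edge_of xz)].
Proof.
move=> nbr; apply/setP=> c; rewrite !inE; apply/imsetP/orP.
  case=> e; rewrite inE => xe ->; have [w [xw ->]] := edge_ofP xe.
  have [wE|wE] := nbr w xw; subst w; [left|right].
      by rewrite (bool_irrelevance xw xy).
    by rewrite (bool_irrelevance xw xz).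
by case=> /eqP->; [exists (edge_of xy)|exists (edge_of xz)];
  rewrite // !inE eqxx.
Qed.

Lemma triangle_def_gt0 (x y z : G) t (alpha : coloring G t) :
  adj x y -> adj y z -> adj z x ->
  (forall w, adj x w -> w = y \/ w = z) ->
  (forall w, adj y w -> w = z \/ w = x) ->
  (forall w, adj z w -> w = x \/ w = y) ->
  proper_coloring alpha -> 0 < def_coloring alpha.
Proof.
move=> xy yz zx nx ny nz pa; rewrite lt0n; apply/eqP=> /eqP.
rewrite sum_nat_eq0 => /forallP d0.
have neq (u v : G) : adj u v -> u != v.
  by move=> uv; apply/eqP=> uE; move: uv; rewrite uE adj_irrefl.
have xz : adj x z by rewrite adj_sym.
have yx : adj y x by rewrite adj_sym.
have zy : adj z y by rewrite adj_sym.
have := d0 x; rewrite (spectrum2 alpha xy xz nx) def_set2.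
have := d0 y; rewrite (spectrum2 alpha yz yx ny) def_set2.
have := d0 z; rewrite (spectrum2 alpha zx zy nz) def_set2.
have := proper_coloring_neq xy xz pa (neq _ _ yz).
have := proper_coloring_neq yz yx pa (neq _ _ zx).
have := proper_coloring_neq zx zy pa (neq _ _ xy).
(* Each edge occurs from both of its ends; identifying the two forms leaves three colors. *)
rewrite (edge_ofC xz zx) (edge_ofC yx xy) (edge_ofC zy yz) /=.
rewrite -!val_eqE /=.
by move: (alpha _) (alpha _) (alpha _) => a b c; lia.
Qed.

(* A vertex weight colors each edge with the sum of the weights of its ends. *)
Definition weight_coloring (t : nat) (g : G -> nat) : coloring G t :=
  [ffun e : edge G => inord (\sum_(v in val e) g v)].

Lemma weight_coloringE t (g : G -> nat) (x y : G) (xy : adj x y) :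
  g x + g y <= t -> weight_coloring t g (edge_of xy) = g x + g y :> nat.
Proof.
have x_y : x \notin [set y].
  by rewrite inE; apply/eqP=> xE; move: xy; rewrite xE adj_irrefl.
by move=> le_t; rewrite ffunE /= big_setU1 //= big_set1 inordK.
Qed.

(** Edges meeting at [x] share the summand [g x], so properness reduces to injectivity of [g] on the
    neighbors of each vertex. The bound by [t] keeps [inord] from falling back on its default
    value. *)
Lemma weight_coloring_proper t (g : G -> nat) :
  (forall x y, adj x y -> 0 < g x + g y <= t) ->
  (forall c, 0 < c <= t -> exists x y, adj x y /\ g x + g y = c) ->
  (forall x y z, adj x y -> adj x z -> g y = g z -> y = z) ->
  proper_coloring (weight_coloring t g).
Proof.
move=> bnd surj inj; apply/and3P; split.
- apply/forallP=> e; have /imsetP[[x y] + eE] := valP e.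
  rewrite inE /= in eE * => xy; have -> : e = edge_of xy by apply: val_inj.
  by have /andP[? ?] := bnd x y xy; rewrite weight_coloringE.
- apply/forallP=> c; apply/implyP=> c0.
  have [|x [y [xy gE]]] := surj c; first by rewrite c0 -ltnS ltn_ord.
  apply/existsP; exists (edge_of xy); rewrite -val_eqE /=.
  by rewrite weight_coloringE gE // -ltnS.
- apply/forallP=> e; apply/forallP=> f; apply/implyP=> /andP[ef].
  case/set0Pn=> x /setIP[xe xf].
  have [y [xy eE]] := edge_ofP xe; have [z [xz fE]] := edge_ofP xf.
  apply: contra ef; rewrite {}eE {}fE => /eqP/(congr1 val) /=.
  have /andP[_ ?] := bnd x y xy; have /andP[_ ?] := bnd x z xz.
  rewrite !weight_coloringE // => /addnI/(inj _ _ _ xy xz) yE; subst z.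
  by rewrite (bool_irrelevance xy xz).
Qed.

End EdgeOf.

Section TriangleMatching.

Variable l : nat.

(** The left summand holds the corners of the triangle; [inr (i, false)] and [inr (i, true)] are the
    ends of the [i]-th disjoint edge. *)
Definition tm_vertex : finType := ('I_3 + 'I_l * bool)%type.

Definition tm_adj : rel tm_vertex := fun x y =>
  match x, y with
  | inl i, inl j => i != j
  | inr (i, b), inr (j, c) => (i == j) && (b != c)
  | _, _ => false
  end.

Lemma tm_adj_sym : symmetric tm_adj.
Proof.
move=> [i|[i b]] [j|[j c]] //=; first by rewrite eq_sym.
by rewrite (eq_sym i) (eq_sym b).
Qed.

Lemma tm_adj_irrefl : irreflexive tm_adj.
Proof. by move=> [i|[i b]] /=; rewrite !eqxx. Qed.

Definition tm_graph : sgraph := SGraph tm_adj_sym tm_adj_irrefl.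

Definition tm_corner (i : 'I_3) : tm_graph := inl i.

(** [ordS] and [ord_pred] wrap around modulo 3, which treats all corners uniformly. *)
Lemma tm_corner_nbr (i : 'I_3) (w : tm_graph) : adj (tm_corner i) w ->
  w = tm_corner (ordS i) \/ w = tm_corner (ord_pred i).
Proof.
case: w => [j|//]; move: i j => [[|[|[|//]]] ?] [[|[|[|//]]] ?] //= _;
  by [left; congr inl; apply: val_inj | right; congr inl; apply: val_inj].
Qed.

Lemma tm_corner_adj (i : 'I_3) :
  adj (tm_corner i) (tm_corner (ordS i)) /\
  adj (tm_corner i) (tm_corner (ord_pred i)).
Proof. by split; case: i => [[|[|[|//]]] ?]. Qed.

Lemma tm_def_gt0 t (alpha : coloring tm_graph t) :
  proper_coloring alpha -> 0 < def_coloring alpha.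
Proof.
apply: (@triangle_def_gt0 _ (tm_corner ord0) (tm_corner (@Ordinal 3 1 isT))
          (tm_corner (@Ordinal 3 2 isT))) => // w /tm_corner_nbr [] ->;
  by [left; congr inl; apply: val_inj | right; congr inl; apply: val_inj].
Qed.

(* The weights 0, 1, 2 of the corners give the edges of the triangle the *)
(* colors 1, 2, 3.                                                       *)
Definition tm_weight (h : 'I_l -> nat) (x : tm_graph) : nat :=
  match x with
  | inl i => i
  | inr (i, b) => if b then h i else 0
  end.

(** The triangle already uses the colors 1, 2, 3, so [h], which colors the disjoint edges, only has
    to supply the colors above 3. *)
Lemma tm_has_def1 t (h : 'I_l -> nat) :
  2 < t -> (forall i, 0 < h i <= t) ->
  (forall c, 3 < c <= t -> exists i, h i = c) -> has_def tm_graph t 1.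
Proof.
move=> t3 hb hs; pose g := tm_weight h.
have bnd x y : adj x y -> 0 < g x + g y <= t.
  case: x y => [i|[i b]] [j|[j c]] //=.
    by rewrite -val_eqE /=; have := ltn_ord i; have := ltn_ord j; lia.
  by case/andP=> /eqP<-; case: b c => [] [] // _; rewrite ?addn0 ?add0n hb.
have surj c : 0 < c <= t -> exists x y, adj x y /\ g x + g y = c.
  case: c => [|[|[|[|c]]]] // ct.
  - by exists (tm_corner ord0), (tm_corner (@Ordinal 3 1 isT)).
  - by exists (tm_corner ord0), (tm_corner (@Ordinal 3 2 isT)).
  - by exists (tm_corner (@Ordinal 3 1 isT)), (tm_corner (@Ordinal 3 2 isT)).
  have [//|i hi] := hs c.+4.
  by exists (inr (i, true)), (inr (i, false)); rewrite /= eqxx addn0.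
have inj x y z : adj x y -> adj x z -> g y = g z -> y = z.
  case: x y z => [i|[i b]] [j|[j c]] [k|[k d]] //=.
    by move=> _ _ /val_inj->.
  by move=> /andP[/eqP<- bc] /andP[/eqP<- bd] _; case: b c d bc bd => [] [] [].
apply/has_defP; exists (weight_coloring t g).
  exact: weight_coloring_proper.
(* Corner 1 meets the colors 1 and 3 and has deficiency 1; the other corners meet consecutive
   colors. *)
rewrite /def_coloring (eq_bigr (fun v => (v == inl (@Ordinal 3 1 isT)) : nat)).
  by rewrite (bigD1 (inl (@Ordinal 3 1 isT))) //= big1 // => v /negPf->.
move=> [i|[i b]] _.
  have [iS iP] := tm_corner_adj i.
  rewrite (spectrum2 _ iS iP (@tm_corner_nbr i)) def_set2.
  have /andP[_ bS] := bnd _ _ iS; have /andP[_ bP] := bnd _ _ iP.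
  rewrite !weight_coloringE //.
  by case: i {iS iP bS bP} => [[|[|[|//]]] ?].
have ib : adj (inr (i, b) : tm_graph) (inr (i, ~~ b)).
  by rewrite /= eqxx; case: b.
(* The only neighbor is taken twice, which makes the spectrum a singleton. *)
rewrite (spectrum2 _ ib ib); first by rewrite def_set2 subnn.
by move=> [//|[j c]] /andP[/eqP<-]; case: b c {ib} => [] [] // _; left.
Qed.

Lemma tm_def_graph : def_graph tm_graph = 1.
Proof.
have /has_defP[alpha pa da] : has_def tm_graph 3 1.
  (* With three colors no color above 3 is left to supply, so every disjoint edge may get color
     1. *)
  by apply: (@tm_has_def1 _ (fun=> 1)) => // c; lia.
apply/eqP; rewrite eqn_leq -{1}da def_graph_le //=.
have [t /has_defP[beta pb <-]] := def_graph_attained tm_graph.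
exact: tm_def_gt0.
Qed.

End TriangleMatching.

Lemma w_def_le (G : sgraph) t : has_def G t (def_graph G) -> w_def G <= t.
Proof. by rewrite /w_def; case: ex_minnP => m _; apply. Qed.

Lemma W_def_ge (G : sgraph) t : has_def G t (def_graph G) -> t <= W_def G.
Proof. by rewrite /W_def; case: ex_maxnP => m _; apply. Qed.

Theorem theorem2p4 (l : nat) (hl : 0 < l) :
  exists G : sgraph, 0 < def_graph G /\ l <= W_def G - w_def G.
Proof.
exists (tm_graph l); rewrite tm_def_graph; split=> //.
have lo : w_def (tm_graph l) <= 3.
  apply: w_def_le; rewrite tm_def_graph.
  by apply: (@tm_has_def1 _ _ (fun=> 1)) => // c; lia.
have hi : l + 3 <= W_def (tm_graph l).
  apply: W_def_ge; rewrite tm_def_graph.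
  apply: (@tm_has_def1 _ _ (fun i => i + 4)) => [|i|c cl].
  - by rewrite addn3.
  - by have := ltn_ord i; lia.
  - have cl4 : c - 4 < l by lia.
    by exists (Ordinal cl4) => /=; lia.
lia.
Qed.
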